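(* Let $n\ge 2$ be an integer, let $A_1A_2\ldots A_{n+1}$ be a (non-degenerate) $n$-simplex in $\mathbb{R}^n$, let $M$ be a point in its interior, and let $N_1N_2\ldots N_{n+1}$ be the cevian simplex corresponding to $M$. Put $$\theta_n=\frac{n+1-\sqrt{n^{2}+2n-3}}{2}.$$ Then $$[MN_1N_2\ldots N_{n}]\le\frac{(n-1)^2}{(n-\theta_n)^{n+3}}\cdot[A_1A_2\ldots A_{n+1}],$$ and equality holds when $M$ has barycentric coordinates $(\theta_n,\theta_n,\ldots,\theta_n,1-n\theta_n)$, in this order, with respect to $A_1A_2\ldots A_{n+1}$.
   Context: $[X_1X_2\ldots X_{n+1}]$ denotes the ($n$-dimensional, nonnegative) volume of the $n$-simplex with vertices $X_1,\ldots,X_{n+1}$. For an interior point $M$ of the simplex $A_1A_2\ldots A_{n+1}$, the point $N_i$ ($i=1,\ldots,n+1$) is the foot of the cevian from $A_i$ through $M$, i.e. the intersection of the line $A_iM$ with the facet opposite to $A_i$ (the facet spanned by the vertices $A_j$, $j\ne i$); the cevian simplex corresponding to $M$ is the simplex $N_1N_2\ldots N_{n+1}$. The barycentric coordinates $(\lambda_1,\ldots,\lambda_{n+1})$ of $M$ with respect to $A_1A_2\ldots A_{n+1}$ are normalized: $M=\sum_{i=1}^{n+1}\lambda_iA_i$ with $\sum_{i=1}^{n+1}\lambda_i=1$. *)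

(* Defs.v *)
(* Points of R^n are row vectors; the vertices of an n-simplex are indexed from 0
   by 'I_n.+1. *)
From HB Require Import structures.
From mathcomp Require Export all_boot all_order all_algebra.
From mathcomp Require Export all_classical all_reals all_analysis.

Set Implicit Arguments.
Unset Strict Implicit.
Unset Printing Implicit Defensive.

Export Order.TTheory GRing.Theory Num.Theory.
Export numFieldNormedType.Exports.

Local Open Scope classical_set_scope.
Local Open Scope ring_scope.

Section Defs.
Context {R : realType}.

Definition box n (a b : 'rV[R]_n) : set 'rV[R]_n :=
  [set x | forall i, a 0 i <= x 0 i <= b 0 i].

Definition box_volume n (a b : 'rV[R]_n) : R := \prod_i (b 0 i - a 0 i).

(* n-dimensional Lebesgue outer measure, from countable covers by boxes. It is
   the Lebesgue measure on measurable sets, in particular on simplices, which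
   are compact. *)
Definition volume n (E : set 'rV[R]_n) : \bar R :=
  ereal_inf [set v | exists a b : nat -> 'rV[R]_n,
    [/\ forall k i, a k 0 i <= b k 0 i,
        E `<=` \bigcup_k box (a k) (b k)
      & v = (\sum_(0 <= k <oo) (box_volume (a k) (b k))%:E)%E]].

Definition simplex m n (X : 'I_m -> 'rV[R]_n) : set 'rV[R]_n :=
  [set x | exists t : 'I_m -> R,
    [/\ forall i, 0 <= t i, \sum_i t i = 1 & x = \sum_i t i *: X i]].

Definition affinely_independent m n (X : 'I_m -> 'rV[R]_n) : Prop :=
  forall c : 'I_m -> R,
    \sum_i c i = 0 -> \sum_i c i *: X i = 0 -> forall i, c i = 0.

Definition facet n (A : 'I_n.+1 -> 'rV[R]_n) (i : 'I_n.+1) : set 'rV[R]_n :=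
  simplex (fun j : 'I_n => A (lift i j)).

Definition line n (P Q : 'rV[R]_n) : set 'rV[R]_n :=
  [set P + t *: (Q - P) | t in [set: R]].

(* Membership suffices: for affinely independent A and M interior to the
   simplex, the line meets the facet in exactly one point. *)
Definition cevian_feet n (A : 'I_n.+1 -> 'rV[R]_n) (M : 'rV[R]_n)
    (N : 'I_n.+1 -> 'rV[R]_n) : Prop :=
  forall i, (line (A i) M `&` facet A i) (N i).

(* The n+1 points M, N 0, ..., N (n-1); the last point N n is left out. *)
Definition cons_but_last n (M : 'rV[R]_n) (N : 'I_n.+1 -> 'rV[R]_n) :
    'I_n.+1 -> 'rV[R]_n :=
  fun i => if unlift ord0 i is Some j then N (lift ord_max j) else M.

Definition barycentric_coordinates n (A : 'I_n.+1 -> 'rV[R]_n) (M : 'rV[R]_n)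
    (lam : 'I_n.+1 -> R) : Prop :=
  \sum_i lam i = 1 /\ M = \sum_i lam i *: A i.

Definition theta (n : nat) : R :=
  (n%:R + 1 - Num.sqrt (n%:R ^+ 2 + 2 * n%:R - 3)) / 2.

End Defs.

Arguments theta : clear implicits.

(* Main.v *)
Require Import Defs.
From mathcomp Require Import ring lra.

(** Why the theorem is true.

    Volume of a simplex. Choosing a vertex [X k], a simplex is the image of the
    standard corner simplex under [s |-> s *m edges k X + X k], where the rows
    of [edges k X] are the edge vectors issued from [X k]. The volume is
    invariant under translation and multiplied by [`|\det T|] under an
    invertible linear map [T] ([scales_volume_unit]), so that the volumes of
    two simplices are in the ratio of their edge determinants
    ([volume_simplex]); the volume of the corner simplex itself never matters.

    The determinant formula is proved directly on the outer measure. Countable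
    subadditivity ([volume_bigcup_le]) reduces an inequality
    [volume (f @` E) <= c * volume E] to the case where [E] is a box
    ([volume_image_le]). Gaussian elimination reduces a general [T] to matrices
    that differ from the identity in a single row [k]. Such a matrix sends a
    box into a box that is too large only because of its extent in direction
    [k]; cutting the source box [m] times in halves along [k] divides this
    excess by [2 ^ m] ([volume_subst_row_box_bisect]). The inverse matrix has
    the same shape, so the inequality obtained in the limit is an equality.

    The ratio. Let [lam] be the barycentric coordinates of [M], all positive
    since [M] is interior. Affine independence forces
    [N i - M = lam i / (1 - lam i) *: (M - A i)], and
    [M - A i] is row [i] of minus (identity minus a matrix of rank one) in the
    basis of the edges issued from the last vertex. Hence the ratio of
    the volumes is
    [lam ord_max * \prod_(i != ord_max) lam i / (1 - lam i)]
    ([det_edges_cevian]).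

    The maximum. Write [t] for theta, the root of
    [1 - n t = t (1 - t)] in the unit interval, and
    [p = (t, ..., t, 1 - n t)]. Since [1 - lam i] is the sum of the other
    coordinates, the weighted arithmetic-geometric mean inequality bounds it
    from below by a monomial in [lam], with equality at [lam = p]. After this
    substitution the quadratic equation of [t] makes the remaining monomial
    proportional to [\prod_j lam j ^ p j], and a second use of the same
    inequality, now with [\sum_j lam j = 1], bounds that by its value at [p]
    ([cevian_ratio_le]). Both steps are equalities at [p], and the value there
    is the stated constant by the same quadratic equation
    ([cevian_ratio_opt]). *)

Set Implicit Arguments.
Unset Strict Implicit.
Unset Printing Implicit Defensive.

Local Open Scope classical_set_scope.
Local Open Scope ring_scope.

(** * The outer measure *)

Section Volume.
Context {R : realType}.
Implicit Types n : nat.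

Lemma box_volume_ge0 n (a b : 'rV[R]_n) :
  (forall i, a 0 i <= b 0 i) -> 0 <= box_volume a b.
Proof. by move=> ab; apply: prodr_ge0 => i _; rewrite subr_ge0. Qed.

Lemma volume_le n (E F : set 'rV[R]_n) :
  E `<=` F -> (volume E <= volume F)%E.
Proof.
move=> EF; apply: ereal_inf_le_tmp => _ [a [b [ab Fab ->]]].
by exists a, b; split=> //; exact: subset_trans Fab.
Qed.

Lemma volume_ge0 n (E : set 'rV[R]_n) : (0 <= volume E)%E.
Proof.
apply: le_ereal_inf_tmp => _ [a [b [ab _ ->]]].
by apply: nneseries_ge0 => k _ _; rewrite lee_fin box_volume_ge0.
Qed.

(** In dimension 0 this fails: a box then has volume 1, and a cover by
    infinitely many boxes cannot be padded with boxes of volume 0. *)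
Lemma volume_box_le n (a b : 'rV[R]_n) : (0 < n)%N ->
  (forall i, a 0 i <= b 0 i) -> (volume (box a b) <= (box_volume a b)%:E)%E.
Proof.
move=> n0 ab; apply: ereal_inf_lbound.
exists (fun k => if k == 0%N then a else 0), (fun k => if k == 0%N then b else 0).
split.
- by move=> [|k] i.
- by move=> x ?; exists 0%N.
rewrite (@nneseries_split _ _ 0 1) => [|[|k] _]; last 2 first.
- by rewrite lee_fin box_volume_ge0.
- by rewrite lee_fin box_volume_ge0.
rewrite add0n big_nat1 eseries0 ?adde0// => -[//|k] _ _ /=.
by rewrite /box_volume (bigD1 (Ordinal n0))//= subrr mul0r.
Qed.

Lemma volume0 n : (0 < n)%N -> volume (set0 : set 'rV[R]_n) = 0%E.
Proof.
move=> n0; apply/eqP; rewrite eq_le volume_ge0 andbT.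
apply: (@le_trans _ _ (volume (box (0 : 'rV[R]_n) 0))); first exact: volume_le.
apply: (le_trans (volume_box_le n0 _)) => [i|]; first by [].
by rewrite /box_volume (bigD1 (Ordinal n0))//= subrr mul0r.
Qed.

(** Cover each [F k] within [e / 2 ^ k.+1] of its volume and enumerate all the
    boxes along a bijection between [nat] and [nat * nat]. *)
Lemma volume_bigcup_le n (F : nat -> set 'rV[R]_n) :
  (volume (\bigcup_k F k) <= \sum_(0 <= k <oo) volume (F k))%E.
Proof.
have [[i ioo]|] := pselect (exists i, volume (F i) = +oo%E).
  rewrite (eseries_pinfty _ _ ioo) ?leey// => k _.
  by rewrite -ltNye (lt_le_trans _ (volume_ge0 _)).
rewrite -forallNE => Foo.
suff add2e (e : {posnum R}) :
    (volume (\bigcup_k F k) <= \sum_(0 <= k <oo) volume (F k) + e%:num%:E)%E.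
  by apply/lee_addgt0Pr => _/posnumP[].
rewrite (le_trans _ (epsilon_trick _ _ _))//; last first.
  by move=> k; exact: volume_ge0.
pose P k (c : (nat -> 'rV[R]_n) * (nat -> 'rV[R]_n)) :=
  [/\ forall j i, c.1 j 0 i <= c.2 j 0 i,
      F k `<=` \bigcup_j box (c.1 j) (c.2 j)
    & (\sum_(0 <= j <oo) (box_volume (c.1 j) (c.2 j))%:E
       <= volume (F k) + (e%:num / (2 ^ k.+1)%:R)%:E)%E].
have [c Pc] : {c & forall k, P k (c k)}.
  apply: (@choice _ _ P) => k.
  have ek : 0 < e%:num / (2 ^ k.+1)%:R :> R by [].
  have /(lb_ereal_inf_adherent ek) : volume (F k) \is a fin_num.
    by rewrite ge0_fin_numE ?volume_ge0// ltey; apply/eqP/Foo.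
  move=> [_ [a [b [ab Fab ->]]] lt_e].
  by exists (a, b); split=> //; exact: ltW lt_e.
pose g (p : nat * nat) :=
  (box_volume ((c p.1).1 p.2) ((c p.1).2 p.2))%:E.
have g_ge0 p : (0 <= g p)%E.
  by rewrite lee_fin box_volume_ge0//; have [] := Pc p.1.
apply: (@le_trans _ _ (\sum_(0 <= k <oo) \sum_(0 <= j <oo) g (k, j))%E); last first.
  apply: lee_nneseries => k *; last by have [] := Pc k.
  by apply: nneseries_ge0.
have /card_esym/ppcard_eqP[f] := card_nat2.
have -> : (\sum_(0 <= k <oo) \sum_(0 <= j <oo) g (k, j))%E
        = (\sum_(0 <= k <oo) g (f k))%E.
  rewrite [LHS]nneseries_esumT => [|k]; last by apply: nneseries_ge0.
  rewrite [RHS]nneseries_esumT//.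
  rewrite (eq_esum (fun k _ => nneseries_esumT (fun j => g_ge0 (k, j)))).
  rewrite esum_esum//= (reindex_esum [set: nat] _ f).
    by apply: eq_esum => k _; case: (f k).
  have -> : [set: nat] `*`` (fun=> [set: nat]) = [set: nat * nat].
    by apply/seteqP; split.
  exact: bij.
apply: ereal_inf_lbound; exists (fun k => (c (f k).1).1 (f k).2),
  (fun k => (c (f k).1).2 (f k).2); split=> //.
- by move=> k i; have [] := Pc (f k).1.
- move=> x [k _ Fkx]; have [_ /(_ x Fkx)[j _ jx] _] := Pc k.
  by exists (f^-1%FUN (k, j)) => //=; rewrite invK ?inE.
Qed.

(** Positive dimension makes the empty tail of [bigcup2 E F] negligible. *)
Lemma volumeU_le n (E F : set 'rV[R]_n) : (0 < n)%N ->
  (volume (E `|` F) <= volume E + volume F)%E.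
Proof.
move=> n0; rewrite -bigcup2E; apply: le_trans (volume_bigcup_le _) _.
rewrite (@nneseries_split _ _ 0 2) => [|k _]; last exact: volume_ge0.
rewrite add0n big_nat_recl//= big_nat1/= eseries0 ?adde0//.
by move=> [|[|k]]// _ _; rewrite /bigcup2/= volume0.
Qed.

(** A bound on boxes transfers to all sets, since [f] maps covers to covers. *)
Lemma volume_image_le n (f : 'rV[R]_n -> 'rV[R]_n) (c : R) : 0 < c ->
    (forall a b : 'rV[R]_n, (forall i, a 0 i <= b 0 i) ->
       (volume (f @` box a b) <= (c * box_volume a b)%:E)%E) ->
  forall E, (volume (f @` E) <= c%:E * volume E)%E.
Proof.
move=> c0 fbox E; rewrite -lee_pdivrMl//; apply: le_ereal_inf_tmp.
move=> _ [a [b [ab Eab ->]]]; rewrite lee_pdivrMl// -nneseriesZl => [|k _]; last first.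
  by rewrite lee_fin box_volume_ge0.
apply: (@le_trans _ _ (volume (\bigcup_k (f @` box (a k) (b k))))).
  by rewrite -image_bigcup; apply: volume_le; exact: image_subset.
apply: le_trans (volume_bigcup_le _) _; apply: lee_nneseries => k *.
  exact: volume_ge0.
by rewrite -EFinM; exact: fbox.
Qed.

Lemma volume_translate n (v : 'rV[R]_n) (E : set 'rV[R]_n) : (0 < n)%N ->
  volume [set x + v | x in E] = volume E.
Proof.
move=> n0; have le (w : 'rV[R]_n) F : (volume [set (x + w)%R | x in F] <= volume F)%E.
  rewrite -[leRHS]mul1e; apply: (@volume_image_le n (fun x => x + w) 1) => // a b ab.
  have -> : 1 * box_volume a b = box_volume (a + w) (b + w).
    by rewrite mul1r; apply: eq_bigr => i _; rewrite !mxE opprD addrACA subrr addr0.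
  apply: le_trans (volume_box_le n0 _); last by move=> i; rewrite !mxE lerD2r.
  by apply: volume_le => _ [x xab <-] i; rewrite !mxE !lerD2r.
(* the reverse inequality is the same one for the translation by [- v] *)
apply/eqP; rewrite eq_le le/=.
rewrite -[in leLHS](_ : [set x - v | x in [set x + v | x in E]] = E) ?le//.
by rewrite image_comp -[RHS]image_id; apply: eq_imagel => x _ /=; rewrite addrK.
Qed.
End Volume.

(** * Volume of linear images *)

(** The identity matrix with row [k] replaced by [r]. Invertible matrices are
    products of these, so they replace the usual transvections, dilations and
    transpositions altogether. *)
Definition subst_row {F : pzRingType} n (k : 'I_n) (r : 'rV[F]_n) : 'M[F]_n :=
  \matrix_(i, j) if i == k then r 0 j else (i == j)%:R.

Lemma mul_subst_rowE (F : pzRingType) n (k : 'I_n) (r x : 'rV[F]_n) j :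
  (x *m subst_row k r) 0 j = (if j == k then 0 else x 0 j) + x 0 k * r 0 j.
Proof.
rewrite mxE (bigD1 k)//= mxE eqxx addrC; congr +%R.
case: (eqVneq j k) => [->|jk].
  by rewrite big1// => i ik; rewrite mxE (negbTE ik) mulr0.
rewrite (bigD1 j)//= mxE (negbTE jk) eqxx mulr1 big1 ?addr0// => i /andP[ik ij].
by rewrite mxE (negbTE ik) (negbTE ij) mulr0.
Qed.

Lemma row_subst_row_neq (F : pzRingType) n (k i : 'I_n) (r : 'rV[F]_n) :
  i != k -> row i (subst_row k r) = delta_mx 0 i.
Proof. by move=> ik; apply/rowP => j; rewrite !mxE (negbTE ik) eqxx eq_sym. Qed.

Lemma row_subst_row (F : pzRingType) n (k : 'I_n) (r : 'rV[F]_n) :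
  row k (subst_row k r) = r.
Proof. by apply/rowP => j; rewrite !mxE eqxx. Qed.

(** Expand along row [k]: the cofactors of that row do not depend on it, hence
    are those of the identity matrix. *)
Lemma det_subst_row (F : comNzRingType) n (k : 'I_n) (r : 'rV[F]_n) :
  \det (subst_row k r) = r 0 k.
Proof.
have cofE j : cofactor (subst_row k r) k j = (j == k)%:R.
  have -> : cofactor (subst_row k r) k j = cofactor 1%:M k j.
    rewrite /cofactor; congr (_ * \det _); apply/matrixP => i l.
    by rewrite !mxE eq_sym (negbTE (neq_lift _ _)).
  have := mul_mx_adj (1%:M : 'M[F]_n); rewrite mul1mx det1.
  by move=> /matrixP/(_ j k); rewrite !mxE.
rewrite (expand_det_row _ k) (bigD1 k)//= cofE mxE !eqxx mulr1 big1 ?addr0//.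
by move=> j jk; rewrite cofE (negbTE jk) mulr0.
Qed.

Lemma subst_rowK (F : fieldType) n (k : 'I_n) (r x : 'rV[F]_n) : r 0 k != 0 ->
  x *m subst_row k r *m
    subst_row k (\row_j (if j == k then (r 0 k)^-1 else - (r 0 j / r 0 k))) = x.
Proof.
move=> rk0; apply/rowP => j; rewrite !mul_subst_rowE eqxx mxE.
case: (eqVneq j k) => [->|jk]; first by rewrite !add0r mulfK.
by field.
Qed.

Section LinearImages.
Context {R : realType}.

Definition set_coord n (a : 'rV[R]_n) k c : 'rV[R]_n :=
  \row_j if j == k then c else a 0 j.

(** A box of side [w] is mapped into a box with sides [`|r 0 k| * w k] and
    [w j + `|r 0 j| * w k] for [j != k]. Halving the box along [k] halves the
    unwanted terms [`|r 0 j| * w k], while the two factors [w k / 2] add up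
    to [w k] again. *)
Lemma volume_subst_row_box_bisect n (k : 'I_n) (r a b : 'rV[R]_n) m :
  (forall i, a 0 i <= b 0 i) ->
  (volume [set (x *m subst_row k r)%R | x in box a b]
   <= (`|r 0 k| * (b 0 k - a 0 k) * \prod_(j | j != k)
        (b 0 j - a 0 j + `|r 0 j| * (b 0 k - a 0 k) * 2^-1 ^+ m))%:E)%E.
Proof.
have n0 : (0 < n)%N by apply: leq_ltn_trans (ltn_ord k).
elim: m a b => [|m IH] a b ab.
  (* [lo] and [hi] delimit the bounding box of the image *)
  pose lo i := (if i == k then 0 else a 0 i) +
    (if 0 <= r 0 i then a 0 k * r 0 i else b 0 k * r 0 i).
  pose hi i := (if i == k then 0 else b 0 i) +
    (if 0 <= r 0 i then b 0 k * r 0 i else a 0 k * r 0 i).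
  have abk := ab k.
  have loP x i : box a b x -> lo i <= (x *m subst_row k r) 0 i <= hi i.
    move=> xab; rewrite mul_subst_rowE /lo /hi.
    have /andP[? ?] := xab i; have /andP[? ?] := xab k.
    apply/andP; split; apply: lerD; rewrite ?lexx//; try by case: eqP.
      by case: (leP 0 (r 0 i)) => ri; [rewrite ler_wpM2r | rewrite ler_wnM2r// ltW].
    by case: (leP 0 (r 0 i)) => ri; [rewrite ler_wpM2r | rewrite ler_wnM2r// ltW].
  have lohi i : lo i <= hi i.
    have /(loP a i)/andP[] : box a b a by move=> j; rewrite lexx ab.
    exact: le_trans.
  apply: (@le_trans _ _ (box_volume (\row_i lo i) (\row_i hi i))%:E).
    apply: le_trans (volume_box_le n0 _); last by move=> i; rewrite !mxE.
    by apply: volume_le => _ [x xab <-] i; have := loP x i xab; rewrite !mxE.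
  rewrite lee_fin /box_volume (bigD1 k)//= !mxE/=.
  rewrite le_eqVlt; apply/orP; left; apply/eqP; congr (_ * _).
    rewrite /lo /hi eqxx; case: (leP 0 (r 0 k)) => rk.
      by rewrite ger0_norm//; ring.
    by rewrite ltr0_norm//; ring.
  apply: eq_bigr => j jk; rewrite !mxE /lo /hi (negbTE jk) expr0 mulr1.
  case: (leP 0 (r 0 j)) => rj.
    by rewrite ger0_norm//; ring.
  by rewrite ltr0_norm//; ring.
have abk := ab k.
pose c := (a 0 k + b 0 k) / 2.
have ac : a 0 k <= c by rewrite /c; lra.
have cb : c <= b 0 k by rewrite /c; lra.
have ab1 i : a 0 i <= set_coord b k c 0 i by rewrite mxE; case: eqP => [->|].
have ab2 i : set_coord a k c 0 i <= b 0 i by rewrite mxE; case: eqP => [->|].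
have sub : [set (x *m subst_row k r)%R | x in box a b] `<=`
    [set (x *m subst_row k r)%R | x in box a (set_coord b k c)] `|`
    [set (x *m subst_row k r)%R | x in box (set_coord a k c) b].
  move=> _ [x xab <-]; have [xc|cx] := leP (x 0 k) c; [left|right];
    exists x => // i; have /andP[? ?] := xab i; rewrite mxE; apply/andP; split=> //;
    by case: eqP => [->|]//; rewrite ltW.
apply: le_trans (volume_le sub) _; apply: le_trans (volumeU_le _ _ n0) _.
apply: le_trans (leeD (IH _ _ ab1) (IH _ _ ab2)) _.
rewrite -EFinD lee_fin !mxE eqxx.
have -> : c - a 0 k = (b 0 k - a 0 k) / 2 by rewrite /c; field.
have -> : b 0 k - c = (b 0 k - a 0 k) / 2 by rewrite /c; field.
set w := b 0 k - a 0 k.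
rewrite le_eqVlt; apply/orP; left; apply/eqP.
under eq_bigr => j jk do rewrite mxE (negbTE jk).
under [X in _ + _ * X]eq_bigr => j jk do rewrite mxE (negbTE jk).
rewrite -mulrDl -mulrDr -splitr; congr (_ * _).
by apply: eq_bigr => j _; rewrite exprS; congr (_ + _); ring.
Qed.

(** The previous bound is a polynomial in [2^-1 ^+ m]; let [m] go to
    infinity. *)
Lemma volume_subst_row_box n (k : 'I_n) (r a b : 'rV[R]_n) :
  (forall i, a 0 i <= b 0 i) ->
  (volume [set (x *m subst_row k r)%R | x in box a b]
   <= (`|r 0 k| * box_volume a b)%:E)%E.
Proof.
move=> ab; set V := volume _.
pose w j := b 0 j - a 0 j.
(* as a polynomial, the bound is continuous at 0 without further work *)
pose p : {poly R} := (`|r 0 k| * w k)%:P *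
  \prod_(j | j != k) ((w j)%:P + (`|r 0 j| * w k) *: 'X).
have Vp m : (V <= (p.[2^-1 ^+ m])%:E)%E.
  apply: le_trans (volume_subst_row_box_bisect k r m ab) _.
  rewrite /p hornerM hornerC horner_prod lee_fin le_eqVlt; apply/orP; left; apply/eqP.
  by congr (_ * _); apply: eq_bigr => j _; rewrite hornerD hornerC hornerZ hornerX.
have -> : `|r 0 k| * box_volume a b = p.[0].
  rewrite /p hornerM hornerC horner_prod /box_volume (bigD1 k)//= mulrA.
  congr (_ * _); apply: eq_bigr => j _.
  by rewrite hornerD hornerC hornerZ hornerX mulr0 addr0.
have Vge0 : (0 <= V)%E by exact: volume_ge0.
have Vfin : V \is a fin_num.
  by rewrite ge0_fin_numE//; apply: le_lt_trans (Vp 0%N) (ltry _).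
rewrite -(fineK Vfin) lee_fin.
have h2 : `|2^-1 : R| < 1 by rewrite ger0_norm ?invr_ge0// invf_lt1// ltr1n.
have pcvg : p.[2^-1 ^+ m] @[m --> \oo] --> p.[0].
  exact: (continuous_cvg _ (@continuous_horner _ p 0) (cvg_expr h2)).
apply: (cvgr_to_ge pcvg); apply: nearW => m.
by rewrite -lee_fin fineK.
Qed.

Definition scales_volume n (T : 'M[R]_n) := forall E : set 'rV[R]_n,
  volume [set x *m T | x in E] = (`|\det T|%:E * volume E)%E.

(** The inverse matrix is of the same form with pivot [(r 0 k)^-1], which gives
    the reverse inequality. *)
Lemma scales_volume_subst_row n (k : 'I_n) (r : 'rV[R]_n) : r 0 k != 0 ->
  scales_volume (subst_row k r).
Proof.
move=> rk0 E; rewrite det_subst_row; apply/eqP; rewrite eq_le; apply/andP; split.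
  apply: volume_image_le; first by rewrite normr_gt0.
  exact: volume_subst_row_box.
set r' : 'rV[R]_n := \row_j (if j == k then (r 0 k)^-1 else - (r 0 j / r 0 k)).
have r'k : r' 0 k = (r 0 k)^-1 by rewrite mxE eqxx.
rewrite -lee_pdivlMl ?normr_gt0// -normfV -r'k.
have {1}-> : E = [set x *m subst_row k r' | x in [set x *m subst_row k r | x in E]].
  by rewrite image_comp -[LHS]image_id; apply: eq_imagel => x _ /=; rewrite subst_rowK.
apply: volume_image_le; first by rewrite normr_gt0 r'k invr_neq0.
exact: volume_subst_row_box.
Qed.

Lemma scales_volumeM n (S T : 'M[R]_n) :
  scales_volume S -> scales_volume T -> scales_volume (S *m T).
Proof.
move=> sS sT E; rewrite det_mulmx normrM mulrC EFinM -muleA -sS -sT image_comp.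
by congr volume; apply: eq_imagel => x _ /=; rewrite mulmxA.
Qed.

Lemma scales_volume_cancel n (S T : 'M[R]_n) : T \in unitmx ->
  scales_volume T -> scales_volume (S *m T) -> scales_volume S.
Proof.
rewrite unitmxE unitfE => T0 sT sST E.
have := sST E; rewrite det_mulmx normrM mulrC EFinM -muleA.
have -> : [set x *m (S *m T) | x in E] = [set x *m T | x in [set x *m S | x in E]].
  by rewrite image_comp; apply: eq_imagel => x _ /=; rewrite mulmxA.
rewrite sT => /(congr1 (mule (`|\det T|^-1)%:E)).
by rewrite !muleA -EFinM mulVf ?normr_eq0// !mul1e.
Qed.

(** Gaussian elimination, with induction on the number [m] of rows that may
    still differ from those of the identity. Dividing [T] on the right by the
    matrix that has row [k] of [T] as its only nontrivial row turns row [k]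
    into a row of the identity and keeps the later ones; this requires
    [T k k != 0]. *)
Lemma scales_volume_unit n (T : 'M[R]_n) : T \in unitmx -> scales_volume T.
Proof.
suff main m : (m <= n)%N -> forall T : 'M[R]_n, T \in unitmx ->
    (forall i : 'I_n, (m <= i)%N -> row i T = delta_mx 0 i) -> scales_volume T.
  by move=> uT; apply: (main n) => // i; rewrite leqNgt ltn_ord.
elim: m => [_ {}T _ T1|m IH ltmn {}T uT Trow].
  have -> : T = 1%:M by apply/row_matrixP => i; rewrite T1// row1.
  move=> E; rewrite det1 normr1 mul1e -[E in RHS]image_id.
  by congr volume; apply: eq_imagel => x _; rewrite mulmx1.
pose k := Ordinal ltmn.
have pivot (S : 'M[R]_n) : S \in unitmx -> S k k != 0 ->
    (forall i : 'I_n, (m < i)%N -> row i S = delta_mx 0 i) -> scales_volume S.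
  move=> uS Skk Srow; pose P := subst_row k (row k S).
  have uP : P \in unitmx by rewrite unitmxE det_subst_row unitfE mxE.
  have sP : scales_volume P by apply: scales_volume_subst_row; rewrite mxE.
  have -> : S = S *m invmx P *m P by rewrite mulmxKV.
  apply: scales_volumeM => //; apply: IH; first exact: ltnW.
    by rewrite unitmx_mul uS unitmx_inv.
  move=> i; rewrite leq_eqVlt => /orP[/eqP mi|mi].
    have -> : i = k by apply/val_inj.
    by rewrite row_mul -[row k S](@row_subst_row _ _ k) -/P rowE mulmxK.
  have ik : i != k by apply: contraTneq mi => ->; rewrite ltnn.
  by rewrite row_mul Srow// -[in LHS](row_subst_row_neq (row k S) ik) -/P rowE mulmxK.
have [Tkk|/pivot] := eqVneq (T k k) 0; last exact.
(* otherwise row k of T would be a combination of the later rows, which are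
   rows of the identity *)
have [j jk Tkj] : exists2 j : 'I_n, (j < k)%N & T k j != 0.
  apply: contrapT => nex.
  pose u := delta_mx 0 k - \row_i (if (m < i)%N then T k i else 0) : 'rV[R]_n.
  have uT0 : u *m T = 0.
    rewrite mulmxBl -rowE; apply/eqP; rewrite subr_eq0; apply/eqP/rowP => j.
    rewrite !mxE.
    have Tij (i : 'I_n) : (m < i)%N -> T i j = (i == j)%:R.
      by move=> /Trow/rowP/(_ j); rewrite !mxE eqxx eq_sym.
    rewrite (eq_bigr (fun i : 'I_n =>
      if (m < i)%N then T k i * (i == j)%:R else 0)); last first.
      by move=> i _; rewrite mxE; case: ifP => [/Tij->|_]//; rewrite mul0r.
    rewrite (bigD1 j)//= big1 ?addr0 => [|i ij]; last first.
      by rewrite (negbTE ij) mulr0 if_same.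
    rewrite eqxx mulr1; case: (ltngtP m j) => // [jm|mj].
      by apply/eqP/negPn/negP => Tkj; apply: nex; exists j.
    by rewrite -[RHS]Tkk; congr (T k _); apply/val_inj.
  have /rowP/(_ k) : u = 0 by rewrite -(mulmxK uT u) uT0 mul0mx.
  by rewrite !mxE !eqxx ltnn subr0 => /eqP; rewrite oner_eq0.
have jNk : j != k by apply: contraTneq jk => ->; rewrite ltnn.
(* adding column j to column k creates a nonzero pivot *)
pose S := subst_row j (delta_mx 0 j + delta_mx 0 k : 'rV[R]_n).
have Sj : (delta_mx 0 j + delta_mx 0 k : 'rV[R]_n) 0 j = 1.
  by rewrite !mxE !eqxx (negbTE jNk) addr0.
have uS : S \in unitmx by rewrite unitmxE det_subst_row Sj unitr1.
apply: (scales_volume_cancel uS).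
  by apply: scales_volume_subst_row; rewrite Sj oner_eq0.
apply: pivot; first by rewrite unitmx_mul uT uS.
  have -> : (T *m S) k k = (row k T *m S) 0 k by rewrite -row_mul [RHS]mxE.
  by rewrite mul_subst_rowE [k == j]eq_sym (negbTE jNk) !mxE Tkk
    [k == j]eq_sym (negbTE jNk) !eqxx !add0r mulr1.
move=> i mi; rewrite row_mul Trow// -rowE row_subst_row_neq//.
by apply: contraTneq jk => <-; rewrite -leqNgt ltnW.
Qed.
End LinearImages.

(** * Simplices and cevians *)

(** Multiply the block matrix [1, v; u, 1] by [1, 0; - u, 1] on either side:
    the two products are block triangular and have the same determinant. *)
Lemma det_1_sub_rank1 (F : comNzRingType) n (u : 'cV[F]_n) (v : 'rV[F]_n) :
  \det (1%:M - u *m v) = 1 - (v *m u) 0 0.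
Proof.
pose B := block_mx 1%:M v u 1%:M.
pose L := block_mx 1%:M 0 (- u) 1%:M.
have LB : \det (L *m B) = \det (1%:M - u *m v).
  rewrite mulmx_block !mul1mx !mul0mx !mulmx1 !addr0 addNr det_ublock det1 mul1r.
  by rewrite mulNmx addrC.
have BL : \det (B *m L) = 1 - (v *m u) 0 0.
  rewrite mulmx_block !mul1mx !mulmx1 !mulmx0 !add0r subrr mulmxN det_ublock.
  by rewrite det1 mulr1 det_mx11 !mxE eqxx.
by rewrite -LB det_mulmx mulrC -det_mulmx BL.
Qed.

Section Simplices.
Context {R : realType}.
Implicit Types n : nat.

Definition edges n (k : 'I_n.+1) (X : 'I_n.+1 -> 'rV[R]_n) : 'M[R]_n :=
  \matrix_i (X (lift k i) - X k).

Definition corner_simplex n : set 'rV[R]_n :=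
  [set s | (forall i, 0 <= s 0 i) /\ \sum_i s 0 i <= 1].

(** For [\sum_i t i = 1] this is the passage from barycentric coordinates to
    affine coordinates with origin [X k]; for [\sum_i t i = 0] it identifies
    affine dependences of [X] with linear dependences of its edges. *)
Lemma sum_edges n k (X : 'I_n.+1 -> 'rV[R]_n) (t : 'I_n.+1 -> R) :
  \sum_i t i *: X i =
  (\row_i t (lift k i)) *m edges k X + (\sum_i t i) *: X k.
Proof.
rewrite mulmx_sum_row [in RHS](bigD1_ord k)//= [in LHS](bigD1_ord k)//= scalerDl.
rewrite addrCA; congr +%R; rewrite scaler_suml -big_split/=.
by apply: eq_bigr => i _; rewrite rowK mxE scalerBr subrK.
Qed.

Lemma simplex_corner n k (X : 'I_n.+1 -> 'rV[R]_n) :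
  simplex X = [set s *m edges k X + X k | s in @corner_simplex n].
Proof.
apply/seteqP; split=> [x [t [t0 t1 ->]]|_ [s [s0 s1] <-]].
  exists (\row_i t (lift k i)); last by rewrite (sum_edges k) t1 scale1r.
  split=> [i|]; first by rewrite mxE.
  under eq_bigr do rewrite mxE.
  by rewrite -t1 [leRHS](bigD1_ord k)//= lerDr.
exists (fun i => if unlift k i is Some j then s 0 j else 1 - \sum_i s 0 i).
have sum1 : \sum_i (if unlift k i is Some j then s 0 j else 1 - \sum_i s 0 i) = 1.
  rewrite (bigD1_ord k)//= unlift_none; under [X in _ + X]eq_bigr do rewrite liftK.
  by rewrite subrK.
split=> //; first by move=> i; case: unliftP => *; rewrite ?subr_ge0.
rewrite (sum_edges k) sum1 scale1r; congr (_ *m _ + _).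
by apply/rowP => i; rewrite mxE liftK.
Qed.

Lemma volume_simplex n k (X : 'I_n.+1 -> 'rV[R]_n) : (0 < n)%N ->
    edges k X \in unitmx ->
  volume (simplex X) = (`|\det (edges k X)|%:E * volume (@corner_simplex n))%E.
Proof.
move=> n0 uX; rewrite (simplex_corner k) -scales_volume_unit//.
by rewrite -[RHS](volume_translate (X k))// image_comp.
Qed.

Lemma affine_combination_inj n m (A : 'I_m -> 'rV[R]_n) (s t : 'I_m -> R) :
    affinely_independent A -> \sum_i s i = \sum_i t i ->
  \sum_i s i *: A i = \sum_i t i *: A i -> s =1 t.
Proof.
move=> hA st1 st i; apply/eqP; rewrite -subr_eq0; apply/eqP.
apply: (hA (fun i => s i - t i)); first by rewrite sumrB st1 subrr.
by under eq_bigr do rewrite scalerBl; rewrite sumrB st subrr.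
Qed.

Lemma edges_unit n k (A : 'I_n.+1 -> 'rV[R]_n) :
  affinely_independent A -> edges k A \in unitmx.
Proof.
move=> hA; rewrite -row_free_unit; apply: inj_row_free => v vE.
pose c i := if unlift k i is Some j then v 0 j else - \sum_j v 0 j.
have c0 : \sum_i c i = 0.
  rewrite (bigD1_ord k)//= /c unlift_none; under [X in _ + X]eq_bigr do rewrite liftK.
  by rewrite addNr.
have cA : \sum_i c i *: A i = 0.
  rewrite (sum_edges k) c0 scale0r addr0 -[RHS]vE; congr mulmx.
  by apply/rowP => i; rewrite mxE /c liftK.
by apply/rowP => j; have := hA _ c0 cA (lift k j); rewrite /c liftK mxE.
Qed.

(** Pushing [M] slightly away from [A i] keeps it in the simplex and turns the
    coordinate [lam i] into [(1 + d) * lam i - d], which must still be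
    nonnegative. *)
Lemma interior_barycentric_gt0 n (A : 'I_n.+1 -> 'rV[R]_n) M lam :
    affinely_independent A -> (simplex A)° M -> barycentric_coordinates A M lam ->
  forall i, 0 < lam i.
Proof.
move=> hA hM [lam1 ME] i.
pose g (e : R) := M + e *: (M - A i).
have gc : g e @[e --> 0] --> M.
  rewrite -[X in _ --> X]addr0 -[X in _ + X](scale0r (M - A i)).
  by apply: cvgD; [exact: cvg_cst | exact: scalel_continuous].
have [e /= e0 /(_ (e / 2))] := (nbhs_ballP _ _).1 (gc _ hM).
rewrite /ball/= sub0r normrN gtr0_norm ?divr_gt0// ltr_pdivrMr// ltr_pMr// ltr1n.
move=> /(_ erefl).
have : 0 < e / 2 by rewrite divr_gt0.
move: (e / 2) => d d0 [t [t0 t1 gE]].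
have gE' : \sum_j ((1 + d) * lam j - d * (j == i)%:R) *: A j = g d.
  under eq_bigr do rewrite scalerBl -!scalerA.
  rewrite sumrB -!scaler_sumr -ME /g scalerBr addrA scalerDl scale1r; congr (_ - d *: _).
  rewrite (bigD1 i)//= eqxx scale1r big1 ?addr0// => j /negbTE ->.
  by rewrite scale0r.
have sum1 : \sum_j ((1 + d) * lam j - d * (j == i)%:R) = \sum_j t j.
  rewrite sumrB -!mulr_sumr lam1 t1 (bigD1 i)//= eqxx big1 => [|j /negbTE ->//].
  by rewrite addr0 !mulr1 addrK.
have := affine_combination_inj hA sum1 (etrans gE' gE) i.
rewrite eqxx mulr1 => /(canRL (subrK _)) tE.
have : 0 < (1 + d) * lam i by rewrite tE ltr_wpDl.
by rewrite pmulr_rgt0// addr_gt0.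
Qed.

(** Write the foot as [A i + s *: (M - A i)]; its coordinate at [A i], which is
    [1 - s + s * lam i], vanishes because the foot lies on the facet, so that
    [s = 1 / (1 - lam i)]. In particular [lam i <> 1] is a consequence. *)
Lemma cevian_footE n (A : 'I_n.+1 -> 'rV[R]_n) M N lam i :
    affinely_independent A -> barycentric_coordinates A M lam ->
    (line (A i) M `&` facet A i) N ->
  N - M = (lam i / (1 - lam i)) *: (M - A i).
Proof.
move=> hA [lam1 ME] [[s _ <-] [t [t0 t1 NE]]].
pose c j := (1 - s) * (j == i)%:R + s * lam j.
pose d j := if unlift i j is Some k then t k else 0.
have c1 : \sum_j c j = 1.
  rewrite big_split/= -!mulr_sumr lam1 (bigD1 i)//= eqxx big1 => [|j /negbTE ->//].
  by rewrite addr0 !mulr1 subrK.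
have d1 : \sum_j d j = 1.
  by rewrite (bigD1_ord i)//= /d unlift_none add0r; under eq_bigr do rewrite liftK.
have cA : \sum_j c j *: A j = A i + s *: (M - A i).
  under eq_bigr do rewrite scalerDl -!scalerA.
  rewrite big_split/= -!scaler_sumr -ME (bigD1 i)//= eqxx scale1r.
  rewrite big1 => [|j /negbTE ->]; last by rewrite scale0r.
  by rewrite addr0 scalerBl scale1r scalerBr addrAC addrA.
have dA : \sum_j d j *: A j = A i + s *: (M - A i).
  rewrite NE (bigD1_ord i)//= /d unlift_none scale0r add0r.
  by under eq_bigr do rewrite liftK.
have := affine_combination_inj hA (etrans c1 (esym d1)) (etrans cA (esym dA)) i.
rewrite /c /d unlift_none eqxx mulr1 => s1.
have slam : s * (1 - lam i) = 1 by rewrite mulrBr mulr1; lra.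
have lamN : 1 - lam i != 0.
  by apply: contra_eq_neq slam => ->; rewrite mulr0 eq_sym oner_neq0.
have -> : lam i / (1 - lam i) = s - 1.
  by apply: (mulIf lamN); rewrite divfK// mulrBl slam; ring.
by rewrite scalerBl scale1r opprB addrCA addrA.
Qed.

Lemma one_sub_barycentric_gt0 n (lam : 'I_n.+1 -> R) (k : 'I_n.+1) : (0 < n)%N ->
  (forall i, 0 < lam i) -> \sum_i lam i = 1 -> 0 < 1 - lam k.
Proof.
move=> n0 lam0 <-; rewrite (bigD1_ord k)//= [_ + \sum_(_ < _) _]addrC addrK.
rewrite (bigD1 (Ordinal n0))//= ltr_wpDr//.
by apply: sumr_ge0 => j _; exact: ltW.
Qed.

(** The edges of the simplex on [M] and the feet issued from [M] are
    [N i - M = q i *: (M - A i)], and [M - A i] is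
    [\sum_j lam j *: e j - e i] in terms of the edges [e] of [A] issued from
    its last vertex: a diagonal matrix times a rank one perturbation of the
    identity, of determinant [1 - \sum_(j != ord_max) lam j = lam ord_max]. *)
Lemma det_edges_cevian n (A N : 'I_n.+1 -> 'rV[R]_n) M lam : (0 < n)%N ->
    affinely_independent A -> barycentric_coordinates A M lam ->
    (forall i, 0 < lam i) -> cevian_feet A M N ->
  `|\det (edges ord0 (cons_but_last M N))| =
  lam ord_max * \prod_(i < n) (lam (lift ord_max i) / (1 - lam (lift ord_max i)))
  * `|\det (edges ord_max A)|.
Proof.
move=> n0 hA hlam lam0 hN; have [lam1 ME] := hlam.
pose x i := lam (lift ord_max i); pose q i := x i / (1 - x i).
have x1 i : 0 < 1 - x i by exact: one_sub_barycentric_gt0.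
pose E := edges ord_max A; pose one : 'cV[R]_n := const_mx 1.
have -> : edges ord0 (cons_but_last M N) =
    diag_mx (\row_i - q i) *m (1%:M - one *m \row_j x j) *m E.
  apply/row_matrixP => i; rewrite rowK /cons_but_last unlift_none liftK.
  rewrite (cevian_footE hA hlam (hN _)) -/(x i) -/(q i).
  rewrite !row_mul row_diag_mx mxE -!scalemxAl -rowE -row_mul mulmxBl mul1mx.
  have -> : row i (E - one *m \row_j x j *m E) = row i E - (\row_j x j) *m E.
    rewrite raddfB/= -mulmxA [row i (one *m _)]row_mul.
    have -> : row i one = 1%:M by apply/matrixP => a b; rewrite !mxE !ord1.
    by rewrite mul1mx.
  rewrite ME (sum_edges ord_max) lam1 scale1r -/E rowK scaleNr -scalerN opprB.
  by rewrite opprB addrA.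
rewrite !det_mulmx !normrM det_diag det_1_sub_rank1; congr (_ * _).
rewrite mulrC; congr (_ * _).
  have -> : ((\row_j x j) *m one) 0 0 = \sum_i x i.
    by rewrite mxE; apply: eq_bigr => i _; rewrite !mxE mulr1.
  by rewrite -lam1 (bigD1_ord ord_max)//= addrK gtr0_norm.
rewrite normr_prod; apply: eq_bigr => i _; rewrite mxE normrN ger0_norm//.
by rewrite divr_ge0 ?ltW// lam0.
Qed.
End Simplices.

(** * The maximum of the ratio *)

Section CevianRatio.
Context {R : realType}.

(** Sum the tangent inequalities [ln x <= ln m + (x / m - 1)] taken at the mean
    [m]; the linear terms cancel. *)
Lemma jensen_ln (I : finType) (P : pred I) (p u : I -> R) :
    (forall i, 0 < u i) -> (forall i, 0 <= p i) -> \sum_(i | P i) p i = 1 ->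
  \sum_(i | P i) p i * ln (u i) <= ln (\sum_(i | P i) p i * u i).
Proof.
move=> u0 p0 p1; set m := \sum_(i | P i) p i * u i.
have m0 : 0 < m.
  have [i Pi pi0] : exists2 i, P i & p i != 0.
    apply: contrapT => nex; suff : (1 : R) = 0 by apply/eqP/oner_neq0.
    rewrite -p1 big1// => i Pi.
    by apply/eqP/negPn/negP => pi0; apply: nex; exists i.
  rewrite /m (bigD1 i)//= ltr_wpDr//; last by rewrite mulr_gt0// lt_neqAle eq_sym pi0 p0.
  by apply: sumr_ge0 => j _; rewrite mulr_ge0// ltW.
have -> : ln m = \sum_(i | P i) p i * (ln m + (u i / m - 1)).
  under eq_bigr do rewrite mulrDr.
  rewrite big_split/= -mulr_suml p1 mul1r [X in _ + X](_ : _ = 0) ?addr0//.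
  under eq_bigr do rewrite mulrBr mulr1 mulrA.
  by rewrite sumrB -mulr_suml p1 -/m divff ?subrr// gt_eqF.
apply: ler_sum => i _; rewrite ler_wpM2l//.
rewrite -lerBlDl -ln_div ?posrE//.
have := @le_ln1Dx R (u i / m - 1); rewrite addrCA subrr addr0; apply.
by rewrite ltrBrDl subrr divr_gt0.
Qed.

(** [theta R n] is the smaller root of [t ^+ 2 - (n + 1) t + 1 = 0]. *)
Lemma theta_root n : (2 <= n)%N ->
  let t := theta R n in [/\ 0 < t, t < 1 & 1 - n%:R * t = t * (1 - t)].
Proof.
move=> n2 t.
have n2R : 2 <= n%:R :> R by rewrite ler_nat.
pose D : R := n%:R ^+ 2 + 2 * n%:R - 3.
have D0 : 0 <= D by rewrite /D; nra.
have sD : Num.sqrt D ^+ 2 = D by rewrite sqr_sqrtr.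
have s0 : 0 <= Num.sqrt D by exact: sqrtr_ge0.
have tE : t = (n%:R + 1 - Num.sqrt D) / 2 by [].
have sE : Num.sqrt D = n%:R + 1 - 2 * t by rewrite tE; field.
rewrite sE /D in sD s0.
split; [|rewrite ltNge; apply/negP => ?|]; nra.
Qed.

(** The value of the ratio at [lam = (t, ..., t, 1 - n t)]; the quadratic
    equation gives [n - t = (1 - t) / t] and [n - 1 = (1 - t) ^+ 2 / t]. *)
Lemma cevian_ratio_opt n : (2 <= n)%N -> let t := theta R n in
  (n%:R - 1) ^+ 2 / (n%:R - t) ^+ (n + 3) = (1 - n%:R * t) * (t / (1 - t)) ^+ n.
Proof.
move=> n2 t; have [t0 t1 tE] := theta_root n2; rewrite -/t in t0 t1 tE.
have t1N : 0 < 1 - t by rewrite subr_gt0.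
have tN : t != 0 by rewrite gt_eqF.
have tN1 : 1 - t != 0 by rewrite gt_eqF// subr_gt0.
have -> : n%:R - t = (t / (1 - t))^-1.
  by rewrite invf_div; apply/(mulIf tN); rewrite divfK//; lra.
have -> : n%:R - 1 = (1 - t) ^+ 2 / t.
  by apply/(mulIf tN); rewrite divfK// expr2; lra.
by rewrite tE exprVn invrK exprD; field; apply/andP.
Qed.

(** With [u = lam / p] and [L = \sum_j p j * ln (u j)], Jensen's inequality gives
    [L <= 0] and [ln ((1 - lam i) / (1 - t)) >= (L - t * ln (u i)) / (1 - t)].
    By the latter, the logarithm of the ratio divided by its value at [p] is
    at most an expression that collapses to [L]. *)
Lemma cevian_ratio_le n (lam : 'I_n.+1 -> R) : (2 <= n)%N ->
    (forall i, 0 < lam i) -> \sum_i lam i = 1 ->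
  lam ord_max * \prod_(i < n) (lam (lift ord_max i) / (1 - lam (lift ord_max i)))
  <= (n%:R - 1) ^+ 2 / (n%:R - theta R n) ^+ (n + 3).
Proof.
move=> n2 lam0 lam1; rewrite cevian_ratio_opt//.
have [] := theta_root n2; set t := theta R n => t0 t1 tE.
have t1N : 0 < 1 - t by rewrite subr_gt0.
pose p (i : 'I_n.+1) := if i == ord_max then 1 - n%:R * t else t.
have pmax : p ord_max = 1 - n%:R * t by rewrite /p eqxx.
have plift i : p (lift ord_max i) = t by rewrite /p eq_sym (negbTE (neq_lift _ _)).
have p0 i : 0 < p i by rewrite /p; case: ifP => _//; rewrite tE mulr_gt0// subr_gt0.
have p1 : \sum_i p i = 1.
  rewrite (bigD1_ord ord_max)//= pmax; under eq_bigr do rewrite plift.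
  by rewrite sumr_const card_ord -[t *+ n]mulr_natl subrK.
pose u i := lam i / p i.
have u0 i : 0 < u i by rewrite divr_gt0.
have pu i : p i * u i = lam i by rewrite mulrC divfK// gt_eqF.
pose l i := ln (u i).
pose L := \sum_i p i * l i.
have L0 : L <= 0.
  have := jensen_ln (fun i => u0 i) (fun i => ltW (p0 i)) p1.
  by under [X in _ <= ln X]eq_bigr do rewrite pu; rewrite lam1 ln1.
pose q i := lam (lift ord_max i).
have q1 i : 0 < (1 - q i) / (1 - t).
  by rewrite divr_gt0// one_sub_barycentric_gt0// ltnW.
have ineq i : (L - t * l (lift ord_max i)) / (1 - t) <= ln ((1 - q i) / (1 - t)).
  set k := lift ord_max i.
  (* the weights are those of [p] conditioned on [j != k] *)
  have -> : (L - t * l k) / (1 - t) = \sum_(j | j != k) p j / (1 - t) * l j.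
    rewrite /L (bigD1 k)//= plift addrC addrK mulr_suml.
    by apply: eq_bigr => j _; rewrite mulrAC.
  have -> : (1 - q i) / (1 - t) = \sum_(j | j != k) p j / (1 - t) * u j.
    rewrite -lam1 (bigD1 k)//= /q -/k addrC addrK mulr_suml.
    by apply: eq_bigr => j _; rewrite mulrAC pu.
  apply: jensen_ln => // [j|]; first by rewrite divr_ge0 ?subr_ge0 ?ltW.
  rewrite -mulr_suml; move: p1; rewrite (bigD1 k)//= plift => /(canRL (addKr _)) ->.
  by rewrite addrC divff// gt_eqF// subr_gt0.
(* divide by the value at [p] *)
have -> : lam ord_max * \prod_(i < n) (q i / (1 - q i)) =
   (1 - n%:R * t) * (t / (1 - t)) ^+ n *
     (u ord_max * \prod_(i < n) (u (lift ord_max i) / ((1 - q i) / (1 - t)))).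
  rewrite mulrACA -{1}pmax pu; congr (_ * _).
  rewrite -[X in _ ^+ X]card_ord -prodr_const -big_split/=; apply: eq_bigr => i _.
  rewrite /u plift -/(q i); have := q1 i; rewrite pmulr_lgt0 ?invr_gt0 ?subr_gt0// => qi.
  by field; rewrite !gt_eqF// subr_gt0.
rewrite -[leRHS]mulr1 ler_pM2l; last first.
  by rewrite -pmax mulr_gt0 ?exprn_gt0 ?(divr_gt0 t0 t1N).
have -> : u ord_max * \prod_(i < n) (u (lift ord_max i) / ((1 - q i) / (1 - t)))
  = expR (l ord_max + \sum_(i < n) (l (lift ord_max i) - ln ((1 - q i) / (1 - t)))).
  rewrite expRD expR_sum lnK ?posrE//; congr (_ * _); apply: eq_bigr => i _.
  by rewrite expRB !lnK ?posrE.
rewrite -[leRHS]expR0 ler_expR; apply: le_trans L0.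
pose S := \sum_(i < n) l (lift ord_max i).
have LE : L = t * (1 - t) * l ord_max + t * S.
  rewrite /L (bigD1_ord ord_max)//= pmax tE; congr (_ + _).
  by under eq_bigr do rewrite plift; rewrite -mulr_sumr.
have -> : L = l ord_max + \sum_(i < n)
   (l (lift ord_max i) - (L - t * l (lift ord_max i)) / (1 - t)).
  have -> : \sum_(i < n) (l (lift ord_max i) - (L - t * l (lift ord_max i)) / (1 - t))
    = S - (n%:R * L - t * S) / (1 - t).
    rewrite sumrB -mulr_suml sumrB sumr_const card_ord -[L *+ n]mulr_natl.
    by rewrite -mulr_sumr.
  have t1N0 : 1 - t != 0 by rewrite gt_eqF.
  apply: (mulIf t1N0); rewrite mulrDl mulrBl divfK// LE.
  (* the coefficients of S and of l ord_max agree because 1 - n t = t (1 - t) *)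
  have nt : n%:R * t = 1 - t * (1 - t) by rewrite -tE; ring.
  have -> : n%:R * (t * (1 - t) * l ord_max + t * S) =
    (n%:R * t) * ((1 - t) * l ord_max + S) by ring.
  by rewrite nt; ring.
by rewrite lerD2l; apply: ler_sum => i _; rewrite lerD2l lerN2.
Qed.
End CevianRatio.

(** * Comparing the two simplices *)

(** Both volumes are edge determinants times the same volume of the corner
    simplex, which cancels. *)
Lemma volume_cevian_simplex (R : realType) n (A N : 'I_n.+1 -> 'rV[R]_n) M lam :
    (0 < n)%N -> affinely_independent A -> barycentric_coordinates A M lam ->
    (forall i, 0 < lam i) -> cevian_feet A M N ->
  volume (simplex (cons_but_last M N)) =
  ((lam ord_max *
    \prod_(i < n) (lam (lift ord_max i) / (1 - lam (lift ord_max i))))%:E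
   * volume (simplex A))%E.
Proof.
move=> n0 hA hlam lam0 hN.
have uA := edges_unit ord_max hA.
have detN := det_edges_cevian n0 hA hlam lam0 hN.
have uN : edges ord0 (cons_but_last M N) \in unitmx.
  rewrite unitmxE unitfE -normr_eq0 detN gt_eqF// mulr_gt0 ?normr_gt0 -?unitfE//.
  rewrite mulr_gt0//; apply: prodr_gt0 => i _.
  by rewrite divr_gt0// (one_sub_barycentric_gt0 _ n0 lam0)//; have [] := hlam.
rewrite (volume_simplex n0 uN) (volume_simplex n0 uA) detN.
by rewrite [in LHS]EFinM muleA.
Qed.

Unset Implicit Arguments.

Theorem theorem2 (R : realType) (n : nat) (hn : (2 <= n)%N)
    (A : 'I_n.+1 -> 'rV[R]_n) (hA : affinely_independent A)
    (M : 'rV[R]_n) (hM : (simplex A)° M)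
    (N : 'I_n.+1 -> 'rV[R]_n) (hN : cevian_feet A M N) :
  (volume (simplex (cons_but_last M N))
     <= ((n%:R - 1) ^+ 2 / (n%:R - theta R n) ^+ (n + 3))%:E
        * volume (simplex A))%E
  /\ (barycentric_coordinates A M
        (fun i => if i == ord_max then 1 - n%:R * theta R n else theta R n) ->
      volume (simplex (cons_but_last M N))
        = (((n%:R - 1) ^+ 2 / (n%:R - theta R n) ^+ (n + 3))%:E
           * volume (simplex A))%E).
Proof.
have n0 : (0 < n)%N by exact: ltnW.
have ratio lam hlam lam0 := @volume_cevian_simplex _ _ _ _ _ lam n0 hA hlam lam0 hN.
split=> [|hlam].
  have [lam [_ lam1 ME]] := interior_subset hM.
  have hlam : barycentric_coordinates A M lam by [].
  have lam0 := interior_barycentric_gt0 hA hM hlam.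
  rewrite (ratio lam)// lee_wpmul2r ?volume_ge0// lee_fin.
  exact: cevian_ratio_le.
rewrite (ratio _ hlam (interior_barycentric_gt0 hA hM hlam)) cevian_ratio_opt//.
rewrite eqxx; congr ((_ * _)%:E * _)%E.
under eq_bigr => i _ do rewrite eq_sym (negbTE (neq_lift _ _)).
by rewrite prodr_const card_ord.
Qed.
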